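(* Let $(A,\star)$ be an alternative superalgebra, $(V,\mathfrak l,\mathfrak r)$ a bimodule over it, and $T:V\to A$ an even super $\mathcal O$-operator of $(A,\star)$ with respect to $(V,\mathfrak l,\mathfrak r)$. For homogeneous $a,b\in V$ set $$a\succ b=\mathfrak l(T(a))b,\qquad a\prec b=\mathfrak r(T(b))a .$$ Then $(V,\prec,\succ)$ is a pre-alternative superalgebra. Moreover, let $[x,y]=x\star y-(-1)^{|x||y|}y\star x$ be the Malcev superalgebra structure on $A$, let $\rho(x)v=\mathfrak l(x)v-(-1)^{|x||v|}\mathfrak r(x)v$ be its representation on $V$, and let $(V,\cdot)$ be the pre-Malcev superalgebra given by $a\cdot b=\rho(T(a))b$. Then $a\cdot b=a\succ b-(-1)^{|a||b|}b\prec a$ for all homogeneous $a,b\in V$.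
   Context: All vector spaces are finite dimensional over an algebraically closed field $\mathbb K$ of characteristic zero. A super vector space is a $\mathbb Z_2$-graded space; $|x|$ is the parity of a homogeneous element. All products are bilinear and respect the grading. An alternative superalgebra is a super vector space $A$ with a product $\star$ such that, with $as(x,y,z)=(x\star y)\star z-x\star(y\star z)$, for all homogeneous $x,y,z$: $as(x,y,z)+(-1)^{|x||y|}as(y,x,z)=0$ and $as(x,y,z)+(-1)^{|y||z|}as(x,z,y)=0$. A bimodule over $(A,\star)$ is a super vector space $V$ with even linear maps $\mathfrak l,\mathfrak r:A\to gl(V)$ such that for all homogeneous $x,y\in A$, $v\in V$: $\mathfrak l(x\star y)v+(-1)^{|x||y|}\mathfrak l(y\star x)v-\mathfrak l(x)\mathfrak l(y)v-(-1)^{|x||y|}\mathfrak l(y)\mathfrak l(x)v=0$; $\mathfrak r(y)\mathfrak r(x)v+(-1)^{|x||y|}\mathfrak r(x)\mathfrak r(y)v-\mathfrak r(x\star y)v-(-1)^{|x||y|}\mathfrak r(y\star x)v=0$; $\mathfrak r(y)\mathfrak r(x)v+(-1)^{|x||v|}\mathfrak r(y)\mathfrak l(x)v-(-1)^{|x||v|}\mathfrak l(x)\mathfrak r(y)v-\mathfrak r(x\star y)v=0$; $\mathfrak r(y)\mathfrak l(x)v+(-1)^{|y||v|}\mathfrak l(x\star y)v-(-1)^{|y||v|}\mathfrak l(x)\mathfrak l(y)v-\mathfrak l(x)\mathfrak r(y)v=0$. (Equivalently, $(x+a)\circ(y+b)=x\star y+\mathfrak l(x)b+\mathfrak r(y)a$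 makes $A\oplus V$ an alternative superalgebra.) A super $\mathcal O$-operator of $(A,\star)$ with respect to $(V,\mathfrak l,\mathfrak r)$ is a linear map $T:V\to A$ with $T(a)\star T(b)=T(\mathfrak l(T(a))b+\mathfrak r(T(b))a)$ for all homogeneous $a,b\in V$. A pre-alternative superalgebra is a super vector space $A$ with two products $\prec,\succ$ such that, with $x\star y=x\prec y+x\succ y$, for all homogeneous $x,y,z$: $(x\star y)\succ z-x\succ(y\succ z)+(-1)^{|x||y|}(y\star x)\succ z-(-1)^{|x||y|}y\succ(x\succ z)=0$; $(x\prec y)\prec z-x\prec(y\star z)+(-1)^{|y||z|}(x\prec z)\prec y-(-1)^{|y||z|}x\prec(z\star y)=0$; $(x\succ y)\prec z-x\succ(y\prec z)+(-1)^{|x||y|}(y\prec x)\prec z-(-1)^{|x||y|}y\prec(x\star z)=0$; $(x\succ y)\prec z-x\succ(y\prec z)+(-1)^{|y||z|}(x\star z)\succ y-(-1)^{|y||z|}x\succ(z\succ y)=0$. Background on the objects named in the claim: the super commutator of an alternative superalgebra is a Malcev superalgebra bracket, $\rho$ is a representation of it, $T$ is a super $\mathcal O$-operator for $\rho$, and $a\cdot b=\rho(T(a))b$ is then a pre-Malcev product on $V$. *)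

(* Defs.v *)
From HB Require Import structures.
From mathcomp Require Import all_boot all_order all_algebra.
Set Implicit Arguments.
Unset Strict Implicit.
Unset Printing Implicit Defensive.
Import GRing.Theory.
Local Open Scope ring_scope.

(* A super vector space is a [V : vectType K] (hence finite dimensional)
   together with a [superGrading V].  Parities are booleans: [false] is even,
   [true] is odd, addition of parities is [(+)] and (-1)^{|x||y|} is
   [(-1) ^+ (i && j)].  Identities "for all homogeneous x, y" quantify over
   parities i, j and over [x \in G i], [y \in G j]; the vector 0 is homogeneous
   of both parities, for which the multilinear identities below are trivial. *)
Record superGrading (K : fieldType) (V : vectType K) := SuperGrading {
  hpart :> bool -> {vspace V};
  hpart_disjoint : (hpart false :&: hpart true)%VS = 0%VS;
  hpart_full : (hpart false + hpart true)%VS = fullv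
}.

Section Super.
Variable K : fieldType.

Definition hproj (V : vectType K) (G : superGrading V) (i : bool) : 'End(V) :=
  daddv_pi (G i) (G (~~ i)).

Lemma hproj_mem (V : vectType K) (G : superGrading V) (i : bool) (v : V) :
  hproj G i v \in G i.
Proof. exact: memv_pi. Qed.

Lemma hproj_id (V : vectType K) (G : superGrading V) (i j : bool) (v : V) :
  v \in G j -> hproj G i v = if i == j then v else 0.
Proof.
have dG k : (G k :&: G (~~ k))%VS = 0%VS.
  by case: k; [rewrite capvC|]; apply: hpart_disjoint.
have fG k : (G k + G (~~ k))%VS = fullv.
  by case: k; [rewrite addvC|]; apply: hpart_full.
have pid k u : u \in G k -> hproj G k u = u by exact: daddv_pi_id.
case: eqP => [<-|/eqP nij] vG; first exact: pid.
have Ej : j = ~~ i by case: (i) (j) nij => [] [].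
have := @daddv_pi_add _ _ (G i) (G (~~ i)) v (dG i).
rewrite fG memvf => /(_ isT); rewrite -/(hproj G i).
have -> : daddv_pi (G (~~ i)) (G i) v = v.
  by rewrite -Ej; apply: daddv_pi_id; rewrite // Ej capvC.
by move/(canRL (addrK v)); rewrite subrr.
Qed.

(* The bilinear map given by (x, y) |-> (-1)^{|x||y|} f x y on homogeneous
   vectors, see [koszulE]. *)
Definition koszul (U V : vectType K) (W : lmodType K)
    (GU : superGrading U) (GV : superGrading V)
    (f : U -> V -> W) (x : U) (y : V) : W :=
  \sum_(i : bool) \sum_(j : bool)
     (-1) ^+ (i && j) *: f (hproj GU i x) (hproj GV j y).

Definition bilinear_map (U V W : lmodType K) (f : U -> V -> W) : Prop :=
  (forall y, linear (f^~ y)) /\ (forall x, linear (f x)).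

Lemma koszulE (U V : vectType K) (W : lmodType K)
    (GU : superGrading U) (GV : superGrading V) (f : U -> V -> W)
    (i j : bool) (x : U) (y : V) :
  bilinear_map f -> x \in GU i -> y \in GV j ->
  koszul GU GV f x y = (-1) ^+ (i && j) *: f x y.
Proof.
move=> [fl fr] xi yj.
have f0l v : f 0 v = 0.
  by have := fl v (-1) 0 0; rewrite /= !(scaler0, addr0) scaleN1r addNr.
have f0r u : f u 0 = 0.
  by have := fr u (-1) 0 0; rewrite /= !(scaler0, addr0) scaleN1r addNr.
rewrite /koszul !big_bool !(hproj_id _ xi) !(hproj_id _ yj) {xi yj}.
by case: i; case: j; rewrite /= !(f0l, f0r, scaler0, addr0, add0r).
Qed.

Definition super_product (A : vectType K) (G : superGrading A)
    (op : A -> A -> A) : Prop :=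
  bilinear_map op /\
  (forall (i j : bool) (x y : A),
     x \in G i -> y \in G j -> op x y \in G (i (+) j)).

Definition associator (A : vectType K) (star : A -> A -> A) (x y z : A) : A :=
  star (star x y) z - star x (star y z).

Definition alternative_superalgebra (A : vectType K) (G : superGrading A)
    (star : A -> A -> A) : Prop :=
  super_product G star /\
  (forall (i j k : bool) (x y z : A), x \in G i -> y \in G j -> z \in G k ->
     let as_ := associator star in
     as_ x y z + (-1) ^+ (i && j) *: as_ y x z = 0 /\
     as_ x y z + (-1) ^+ (j && k) *: as_ x z y = 0).

Definition even_action (A V : vectType K)
    (GA : superGrading A) (GV : superGrading V) (l : 'Hom(A, 'End(V))) : Prop :=
  forall (i j : bool) (x : A) (v : V),
    x \in GA i -> v \in GV j -> l x v \in GV (i (+) j).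

Definition alternative_bimodule (A V : vectType K)
    (GA : superGrading A) (GV : superGrading V) (star : A -> A -> A)
    (l r : 'Hom(A, 'End(V))) : Prop :=
  [/\ even_action GA GV l, even_action GA GV r &
    forall (i j k : bool) (x y : A) (v : V),
      x \in GA i -> y \in GA j -> v \in GV k ->
      [/\ l (star x y) v + (-1) ^+ (i && j) *: l (star y x) v
            - l x (l y v) - (-1) ^+ (i && j) *: l y (l x v) = 0,
          r y (r x v) + (-1) ^+ (i && j) *: r x (r y v)
            - r (star x y) v - (-1) ^+ (i && j) *: r (star y x) v = 0,
          r y (r x v) + (-1) ^+ (i && k) *: r y (l x v)
            - (-1) ^+ (i && k) *: l x (r y v) - r (star x y) v = 0 &
          r y (l x v) + (-1) ^+ (j && k) *: l (star x y) v
            - (-1) ^+ (j && k) *: l x (l y v) - l x (r y v) = 0]].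

Definition even_linear (V A : vectType K)
    (GV : superGrading V) (GA : superGrading A) (T : 'Hom(V, A)) : Prop :=
  forall (i : bool) (a : V), a \in GV i -> T a \in GA i.

Definition super_O_operator (A V : vectType K) (GV : superGrading V)
    (star : A -> A -> A) (l r : 'Hom(A, 'End(V))) (T : 'Hom(V, A)) : Prop :=
  forall (i j : bool) (a b : V), a \in GV i -> b \in GV j ->
    star (T a) (T b) = T (l (T a) b + r (T b) a).

Definition pre_alternative_superalgebra (A : vectType K) (G : superGrading A)
    (prec succ : A -> A -> A) : Prop :=
  let star x y := prec x y + succ x y in
  [/\ super_product G prec, super_product G succ &
    forall (i j k : bool) (x y z : A), x \in G i -> y \in G j -> z \in G k ->
      [/\ succ (star x y) z - succ x (succ y z)
            + (-1) ^+ (i && j) *: succ (star y x) z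
            - (-1) ^+ (i && j) *: succ y (succ x z) = 0,
          prec (prec x y) z - prec x (star y z)
            + (-1) ^+ (j && k) *: prec (prec x z) y
            - (-1) ^+ (j && k) *: prec x (star z y) = 0,
          prec (succ x y) z - succ x (prec y z)
            + (-1) ^+ (i && j) *: prec (prec y x) z
            - (-1) ^+ (i && j) *: prec y (star x z) = 0 &
          prec (succ x y) z - succ x (prec y z)
            + (-1) ^+ (j && k) *: succ (star x z) y
            - (-1) ^+ (j && k) *: succ x (succ z y) = 0]].

Definition super_commutator (A : vectType K) (G : superGrading A)
    (star : A -> A -> A) (x y : A) : A :=
  star x y - koszul G G (fun u v => star v u) x y.

Lemma super_commutatorE (A : vectType K) (G : superGrading A)
    (star : A -> A -> A) (i j : bool) (x y : A) :
  bilinear_map star -> x \in G i -> y \in G j ->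
  super_commutator G star x y = star x y - (-1) ^+ (i && j) *: star y x.
Proof.
by move=> [bl br] xi yj; rewrite /super_commutator (koszulE _ xi yj).
Qed.

Definition bimodule_rep (A V : vectType K)
    (GA : superGrading A) (GV : superGrading V)
    (l r : 'Hom(A, 'End(V))) (x : A) (v : V) : V :=
  l x v - koszul GA GV (fun y w => r y w) x v.

Lemma bimodule_repE (A V : vectType K)
    (GA : superGrading A) (GV : superGrading V)
    (l r : 'Hom(A, 'End(V))) (i j : bool) (x : A) (v : V) :
  x \in GA i -> v \in GV j ->
  bimodule_rep GA GV l r x v = l x v - (-1) ^+ (i && j) *: r x v.
Proof.
move=> xi vj; rewrite /bimodule_rep (koszulE _ xi vj) //.
by split=> [w a y z|y]; [rewrite linearP lfunE /= lfunE | apply: linearP].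
Qed.

End Super.

(* Main.v *)
Require Import Defs.
From HB Require Import structures.
From mathcomp Require Import all_boot all_order all_algebra.
Import GRing.Theory.
Local Open Scope ring_scope.

(** The O-operator identity says that T carries the sum of the two products
    on V to the product of A.  Hence every star product of elements of V that
    occurs as an operator in a pre-alternative axiom can be pulled through T,
    and each of the four axioms for (a, b, c) turns into one of the four
    bimodule identities: the one whose vector is the argument of (a, b, c) that
    stays in V, the other two arguments being replaced by their images under T.
    That vector is c in the first axiom, a in the second and b in the last two.
    Since T is even, the signs agree up to the symmetry of |x||y|, except in
    the third axiom, which is the third bimodule identity multiplied by the
    sign (-1)^{|a||b|}.  The formula for the pre-Malcev product is the
    definition of rho evaluated at T a, which has the parity of a. *)

Section OperatorProducts.
Variables (K : fieldType) (A V : vectType K).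
Variables (GA : superGrading A) (GV : superGrading V).
Variables (f : 'Hom(A, 'End(V))) (T : 'Hom(V, A)).

Lemma bilinear_action_comp : bilinear_map (fun a b => f (T a) b).
Proof. by split=> [b c x y|a c x y]; rewrite !linearP // lfunE /= lfunE. Qed.

Lemma super_product_succ :
  even_action GA GV f -> even_linear GV GA T ->
  super_product GV (fun a b => f (T a) b).
Proof.
move=> gf gT; split; first exact: bilinear_action_comp.
by move=> i j a b ai bj; apply: gf => //; apply: gT.
Qed.

Lemma super_product_prec :
  even_action GA GV f -> even_linear GV GA T ->
  super_product GV (fun a b => f (T b) a).
Proof.
move=> gf gT; have [[bl br] g] := super_product_succ gf gT.
by split=> // i j a b ai bj; rewrite addbC; apply: g.
Qed.

End OperatorProducts.

Theorem theorem3p4 (K : closedFieldType) (charK0 : [pchar K] =i pred0)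
    (A V : vectType K) (GA : superGrading A) (GV : superGrading V)
    (star : A -> A -> A) (l r : 'Hom(A, 'End(V))) (T : 'Hom(V, A)) :
  alternative_superalgebra GA star ->
  alternative_bimodule GA GV star l r ->
  even_linear GV GA T ->
  super_O_operator GV star l r T ->
  let succ (a b : V) : V := l (T a) b in
  let prec (a b : V) : V := r (T b) a in
  pre_alternative_superalgebra GV prec succ /\
  (let bracket (x y : A) : A := super_commutator GA star x y in
   let rho (x : A) (v : V) : V := bimodule_rep GA GV l r x v in
   let dot (a b : V) : V := rho (T a) b in
   forall (i j : bool) (a b : V), a \in GV i -> b \in GV j ->
     dot a b = succ a b - (-1) ^+ (i && j) *: prec b a).
Proof.
move=> _ [gl gr bimod] gT OT succ prec; split; last first.
  by move=> bracket rho dot i j a b ai bj; apply: bimodule_repE => //; apply: gT.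
split=> [||i j k a b c ai bj ck].
- exact: super_product_prec gr gT.
- exact: super_product_succ gl gT.
have Tstar p q u v : u \in GV p -> v \in GV q ->
    T (r (T v) u + l (T u) v) = star (T u) (T v).
  by move=> up vq; rewrite (OT p q) // addrC.
have [Ta Tb Tc] : [/\ T a \in GA i, T b \in GA j & T c \in GA k].
  by split; exact: gT.
have [ax1 _ _ _] := bimod _ _ _ _ _ _ Ta Tb ck.
have [_ ax2 _ _] := bimod _ _ _ _ _ _ Tb Tc ai.
have [_ _ ax3 ax4] := bimod _ _ _ _ _ _ Ta Tc bj.
rewrite /succ /prec; split.
- rewrite (Tstar i j) // (Tstar j i) // -[RHS]ax1.
  by congr (_ - _); rewrite addrAC.
- rewrite (Tstar j k) // (Tstar k j) // -[RHS]ax2.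
  by congr (_ - _); rewrite addrAC.
- rewrite (Tstar i k) //.
  (* The identity is normalised with a bare r y (r x v), the axiom with a bare
     r y (l x v): the sign, an involution, passes from one form to the other. *)
  have := congr1 ( *:%R ((-1) ^+ (i && j))) ax3.
  rewrite scaler0 !scalerBr scalerDr !scalerA -signr_addb addbb !scale1r.
  by move=> <-; congr (_ - _); rewrite addrC addrA.
- rewrite (Tstar i k) // andbC -[RHS]ax4 [RHS]addrAC.
  by congr (_ - _); rewrite addrAC.
Qed.
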